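(* Let $\theta>0$ and $W=G_\theta M$, where $M$ and $G_\theta$ are independent positive random variables, $G_\theta$ is Gamma$(\theta)$ (shape $\theta$, scale 1), and $M$ has density $f_M$. Let $f_W$ be the density of $W$. For positive numbers $b$ and $c$, let $\tilde W_\theta$ be a random variable with density $$w\mapsto\frac{e^{-(c/b)w}\,b^{-1}f_W(w/b)}{\mathbb{E}[e^{-cG_\theta M}]},\qquad w>0.$$ Then $\tilde W_\theta\overset{d}{=}(b/c)\,G_\theta\,Y_{\theta,c}$ with $G_\theta$ and $Y_{\theta,c}$ independent, where: (i) $Y_{\theta,c}$ is a random variable with density $$\frac{f_Y(y)\,(1-y)^\theta}{\mathbb{E}[(1+cM)^{-\theta}]},\qquad 0<y<1,$$ where $f_Y$ is the density of $Y\overset{d}{=}cM/(cM+1)$, and $\mathbb{E}[(1+cM)^{-\theta}]=\mathbb{E}[e^{-cG_\theta M}]$. (ii) Equivalently, the distribution of $Y_{\theta,c}$ is the distribution of $cM/(cM+1)$ when $M$ is taken with respect to the density $(cm+1)^{-\theta}f_M(m)/\mathbb{E}[e^{-cG_\theta M}]$. (iii) Conversely, $f_M(x)=(1+x)^{\theta-2}f_{Y_{\theta,1}}\!\left(\frac{x}{1+x}\right)\mathbb{E}[(1+M)^{-\theta}]$ for $x>0$, where $f_{Y_{\theta,1}}$ is the density of $Y_{\theta,1}$.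
   Context: $\overset{d}{=}$ denotes equality in distribution. *)

(* Defs.v *)
From HB Require Import structures.
From mathcomp Require Import all_boot all_order all_algebra.
From mathcomp Require Import all_classical all_reals all_analysis.

Set Implicit Arguments.
Unset Strict Implicit.
Unset Printing Implicit Defensive.

Import Order.TTheory GRing.Theory Num.Theory.
Import numFieldNormedType.Exports.

Local Open Scope classical_set_scope.
Local Open Scope ring_scope.

(* Values of [f] outside [D] are irrelevant. *)
Definition is_pdf (R : realType) (D : set R) (f : R -> R) : Prop :=
  [/\ measurable_fun D f,
      (forall x, D x -> 0 <= f x) &
      (\int[lebesgue_measure]_(x in D) (f x)%:E = 1)%E].

(* [X] has density [f] on [D]; in particular [X] lies in [D] almost surely.
   Densities are only determined up to a null set. *)
Definition has_density (R : realType) (d : measure_display)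
    (T : measurableType d) (P : probability T R) (X : T -> R)
    (D : set R) (f : R -> R) : Prop :=
  is_pdf D f /\
  forall A : set R, measurable A ->
    P (X @^-1` A) = (\int[lebesgue_measure]_(x in A `&` D) (f x)%:E)%E.

Definition eq_in_distribution (R : realType)
    (d1 : measure_display) (T1 : measurableType d1) (P1 : probability T1 R)
    (X1 : T1 -> R)
    (d2 : measure_display) (T2 : measurableType d2) (P2 : probability T2 R)
    (X2 : T2 -> R) : Prop :=
  forall A : set R, measurable A -> P1 (X1 @^-1` A) = P2 (X2 @^-1` A).

Definition independent_RVs (R : realType) (d : measure_display)
    (T : measurableType d) (P : probability T R) (X Y : T -> R) : Prop :=
  forall A B : set R, measurable A -> measurable B ->
    P (X @^-1` A `&` Y @^-1` B) = (P (X @^-1` A) * P (Y @^-1` B))%E.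

Definition Gamma_function (R : realType) (theta : R) : R :=
  Rintegral lebesgue_measure `]0, +oo[
    (fun x : R => x `^ (theta - 1) * expR (- x)).

Definition gamma_pdf (R : realType) (theta x : R) : R :=
  x `^ (theta - 1) * expR (- x) / Gamma_function theta.

Definition is_gamma (R : realType) (theta : R) (d : measure_display)
    (T : measurableType d) (P : probability T R) (G : T -> R) : Prop :=
  has_density P G `]0, +oo[ (gamma_pdf theta).

Section Tilting.
Context {R : realType} {d : measure_display} {T : measurableType d}.
Variables (P : probability T R) (theta : R).

Definition ratio_transform (c : R) (M : T -> R) : T -> R :=
  fun t => c * M t / (c * M t + 1).

Definition laplace_GM (G M : T -> R) (c : R) : \bar R :=
  'E_P[fun t => expR (- (c * (G t * M t)))].

Definition power_moment (M : T -> R) (c : R) : \bar R :=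
  'E_P[fun t => (1 + c * M t) `^ (- theta)].

Definition Wtilde_pdf (G M : T -> R) (b c : R) (fW : R -> R) : R -> R :=
  fun w => expR (- (c / b * w)) * (b^-1 * fW (w / b)) / fine (laplace_GM G M c).

Definition Y_theta_c_pdf (M : T -> R) (c : R) (fY : R -> R) : R -> R :=
  fun y => fY y * (1 - y) `^ theta / fine (power_moment M c).

Definition M_tilted_pdf (G M : T -> R) (c : R) (fM : R -> R) : R -> R :=
  fun m => (c * m + 1) `^ (- theta) * fM m / fine (laplace_GM G M c).

(* [Y'] (on any probability space) is distributed as Y_{theta,c}; [fY] is the
   density of Y =d cM/(cM+1), whose existence is part of the claim. *)
Definition is_Y_theta_c (M : T -> R) (c : R)
    (d' : measure_display) (T' : measurableType d') (P' : probability T' R)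
    (Y' : T' -> R) : Prop :=
  exists2 fY : R -> R,
    has_density P (ratio_transform c M) `]0, 1[ fY &
    has_density P' Y' `]0, 1[ (Y_theta_c_pdf M c fY).

End Tilting.

(* Main.v *)
(* Every law involved is identified by integrating a nonnegative measurable
   test function h.  The Gamma density satisfies
     E[exp(-kG) h(G)] = (1 + k)^(-theta) E[h(G / (1 + k))]   (k >= 0),
   so conditioning on M, which is independent of G,
     E[exp(-cGM) h(G, M)] = E[(1 + cM)^(-theta) h(G / (1 + cM), M)].
   With h = 1 this equates the two normalising constants; with h a function of
   b g m it shows that exponentially tilting W amounts to tilting M by
   (1 + cM)^(-theta) and replacing M by M / (1 + cM) = Y / c.  Since
   1 - Y = 1 / (1 + cM), the same weight in terms of Y is (1 - Y)^theta, which
   gives Y_{theta,c}.  The change of variables m = y / (c (1 - y)) provides the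
   density of Y and the converse formula for f_M. *)
Require Import Defs.
From HB Require Import structures.
From mathcomp Require Import all_boot all_order all_algebra.
From mathcomp Require Import all_classical all_reals all_analysis.
From mathcomp Require Import measurable_realfun ring.

Import Order.TTheory GRing.Theory Num.Theory.
Import numFieldNormedType.Exports.

Local Open Scope classical_set_scope.
Local Open Scope ring_scope.

(** * From measures of sets to integrals of test functions *)

Section integral_density.
Context {d1 d2 : measure_display} {T : measurableType d1}
  {U : measurableType d2} {R : realType}.
Variables (mu : {measure set T -> \bar R}) (nu : {measure set U -> \bar R}).
Local Open Scope ereal_scope.
Import HBNNSimple.

(** The hypothesis on [A] is the conclusion for indicators; linearity extends it to simple functions
    and monotone convergence along [nnsfun_approx] to all nonnegative measurable [h]. Neither
    measure has to be finite, so the same statement serves laws of random variables and substitution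
    in Lebesgue integrals. *)
Lemma integral_comp_density (E : set T) (X : T -> U) (D : set U) (f : U -> R) :
    measurable E -> measurable_fun E X -> measurable D -> measurable_fun D f ->
    (forall x, D x -> (0 <= f x)%R) ->
    (forall A, measurable A ->
      mu (E `&` X @^-1` A) = \int[nu]_(x in A `&` D) (f x)%:E) ->
  forall h : U -> \bar R, measurable_fun setT h -> (forall x, 0 <= h x) ->
  \int[mu]_(t in E) h (X t) = \int[nu]_(x in D) (h x * (f x)%:E).
Proof.
move=> mE mX mD mf f0 muE h mh h0.
pose h_ := nnsfun_approx measurableT mh.
have hE x : h x = limn (fun n => (h_ n x)%:E).
  by apply/esym/cvg_lim => //; exact: (cvg_nnsfun_approx measurableT mh).
have nd_h x : {homo (fun n => (h_ n x)%:E) : m n / (m <= n)%N >-> m <= n}.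
  by move=> m n mn; rewrite lee_fin; exact/lefP/nd_nnsfun_approx.
have mhX n : measurable_fun E (fun t => (h_ n (X t))%:E).
  by apply/measurable_EFinP; exact: measurableT_comp.
transitivity (limn (fun n => \int[mu]_(t in E) (h_ n (X t))%:E)).
  rewrite -monotone_convergence//; last by move=> n t _; rewrite lee_fin.
  by apply: eq_integral => t _; exact: hE.
transitivity (limn (fun n => \int[nu]_(x in D) ((h_ n x)%:E * (f x)%:E)));
    last first.
  rewrite -monotone_convergence//; last 3 first.
  - move=> n; apply: emeasurable_funM; apply/measurable_EFinP => //.
    exact: measurable_funTS.
  - by move=> n x Dx; rewrite mule_ge0// lee_fin ?f0.
  - by move=> x Dx m n mn; rewrite lee_wpmul2r ?lee_fin ?f0//; exact: nd_h.
  apply: eq_integral => x /[!inE] Dx; rewrite hE.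
  apply/cvg_lim => //; apply: cvgeZr => //.
  by rewrite -hE; exact: (cvg_nnsfun_approx measurableT mh).
congr (limn _); apply/funext => n.
(* A simple function is the finite sum of its values times the indicators of its fibres, which
   leaves one fibre to treat. *)
have hnE x : (h_ n x)%:E =
    \sum_(y \in range (h_ n)) (y * \1_(h_ n @^-1` [set y]) x)%:E.
  by rewrite fsumEFin //= -fimfunE.
under eq_integral do rewrite hnE.
rewrite ge0_integral_fsum//; last 2 first.
- move=> y; apply/measurable_EFinP; apply: measurable_funM => //.
  exact: measurableT_comp.
- by move=> y t _; rewrite EFinM nnfun_muleindic_ge0.
under [RHS]eq_integral => x _.
  rewrite hnE ge0_mule_fsuml; last first.
    by move=> y; rewrite EFinM nnfun_muleindic_ge0.
  over.
rewrite ge0_integral_fsum//; last 2 first.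
- move=> y; apply: emeasurable_funM; apply/measurable_EFinP => //.
  exact: measurable_funM.
- move=> y x Dx; rewrite mule_ge0 ?lee_fin ?f0//.
  by rewrite -lee_fin EFinM nnfun_muleindic_ge0.
apply: eq_fsbigr => y /[!inE] -[x0 _ <-{y}].
set B := h_ n @^-1` _.
under eq_integral do rewrite EFinM.
have mB : measurable B by exact: measurable_funPTI.
rewrite [LHS]ge0_integralZl ?lee_fin//; last first.
  by apply/measurable_EFinP; exact: measurableT_comp.
under [RHS]eq_integral do rewrite EFinM -muleA.
rewrite [RHS]ge0_integralZl ?lee_fin//; last 2 first.
- by apply: emeasurable_funM; apply/measurable_EFinP.
- by move=> x Dx; rewrite mule_ge0// lee_fin ?f0.
congr (_ * _).
transitivity (mu (E `&` X @^-1` B)).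
  rewrite -(setIidl (@subIsetl _ E (X @^-1` B))).
  rewrite -(integral_indic mu mE)//; last exact: mX.
  by apply: eq_integral => t Et; rewrite !indicE in_setI Et.
rewrite muE// integral_mkcondl; apply: eq_integral => x _.
by rewrite epatch_indic /= muleC.
Qed.

End integral_density.

(** * Independence and iterated integrals *)

Section independence.
Context {d : measure_display} {T : measurableType d} {R : realType}.
Variables (P : probability T R) (X Y : {RV P >-> R}).
Local Open Scope ereal_scope.

(** Moved to the law of [X], this is the partial integral of Tonelli's theorem, whose measurability
    is known. *)
Lemma measurable_integral_fst (h : R * R -> \bar R) :
    measurable_fun setT h -> (forall x, 0 <= h x) ->
  measurable_fun setT (fun y => \int[P]_s h (X s, y)).
Proof.
move=> mh h0.
have := @measurable_fun_fubini_tonelli_G _ _ _ _ _ (distribution P X) h mh h0.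
congr measurable_fun; apply/funext => y; rewrite /fubini_G.
rewrite (@ge0_integral_distribution _ _ _ _ _ _ X (fun x => h (x, y)))//.
exact: measurableT_comp.
Qed.

(** Independence says that the joint law agrees with the product of the marginal laws on rectangles,
    hence everywhere by uniqueness of the product measure; Tonelli then splits the integral, with
    [Y] outermost. *)
Lemma independent_integral (h : R * R -> \bar R) :
    independent_RVs P X Y ->
    measurable_fun setT h -> (forall x, 0 <= h x) ->
  \int[P]_t h (X t, Y t) = \int[P]_t \int[P]_s h (X s, Y t).
Proof.
move=> XY mh h0.
have mXY : measurable_fun setT (fun t => (X t, Y t)).
  exact: measurable_fun_pair.
pose XY_mixin := isMeasurableFun.Build _ _ _ _ _ mXY.
pose XYf : {RV P >-> (R * R)%type} := HB.pack (fun t => (X t, Y t)) XY_mixin.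
rewrite -(ge0_integral_distribution XYf mh h0).
transitivity (\int[distribution P X \x distribution P Y]_z h z).
  apply: eq_measure_integral => A mA _; apply/esym.
  exact: product_measure_unique.
rewrite fubini_tonelli2// ge0_integral_distribution//.
- apply: eq_integral => t _ /=; rewrite /fubini_G.
  rewrite (@ge0_integral_distribution _ _ _ _ _ _ X (fun x => h (x, Y t)))//.
  exact: measurableT_comp.
- exact: measurable_fun_fubini_tonelli_G.
- by move=> y; exact: integral_ge0.
Qed.

Lemma independent_integralM (f g : R -> \bar R) :
    independent_RVs P X Y ->
    measurable_fun setT f -> (forall x, 0 <= f x) ->
    measurable_fun setT g -> (forall x, 0 <= g x) ->
  \int[P]_t (f (X t) * g (Y t)) = \int[P]_t f (X t) * \int[P]_t g (Y t).
Proof.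
move=> XY mf f0 mg g0.
have fX0 : 0 <= \int[P]_t f (X t) by exact: integral_ge0.
rewrite (independent_integral (fun x => f x.1 * g x.2) XY); last 2 first.
- apply: emeasurable_funM.
    by apply: (measurableT_comp mf); exact: measurable_fst.
  by apply: (measurableT_comp mg); exact: measurable_snd.
- by move=> x; rewrite mule_ge0.
rewrite -ge0_integralZl//; last exact: (measurableT_comp mg).
apply: eq_integral => t _ /=; rewrite ge0_integralZr//.
exact: (measurableT_comp mf).
Qed.

End independence.

(** * The measure with a given density *)

Section density_measure.
Context {d : measure_display} {T : measurableType d} {R : realType}.
Variables (mu : {measure set T -> \bar R}) (f : T -> \bar R).
Local Open Scope ereal_scope.

(** The proofs about [f] are arguments so that the measure structure declared below can be inferred
    from the term itself. *)
Definition density_measure of measurable_fun setT f & (forall x, 0 <= f x) :=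
  fun A : set T => \int[mu]_(x in A) f x.

Variables (mf : measurable_fun setT f) (f0 : forall x, 0 <= f x).
Local Notation nu := (density_measure mf f0).

Let nu0 : nu set0 = 0. Proof. exact: integral_set0. Qed.

Let nu_ge0 A : 0 <= nu A. Proof. exact: integral_ge0. Qed.

Let nu_sigma_additive : semi_sigma_additive nu.
Proof. exact: semi_sigma_additive_nng_induced. Qed.

HB.instance Definition _ := isMeasure.Build _ _ _ nu
  nu0 nu_ge0 nu_sigma_additive.

End density_measure.
Arguments density_measure {d T R} mu {f} mf f0.

(** * Change of variables between the positive half line and a set [J] *)

Section substitution.
Context {R : realType}.
(** [F] maps the positive half line increasingly onto [J], with derivative [F'] and inverse [psi].
    Regularity is asked at 0 too, so that closed intervals starting at 0 are covered. [F_onto] is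
    phrased through intermediate values, which fits a bounded as well as an unbounded [J]. *)
Variables (F F' psi : R -> R) (J : set R).
Hypotheses (mJ : measurable J) (mpsi : measurable_fun setT psi)
  (mF' : measurable_fun setT F')
  (dF : forall x : R, 0 <= x -> is_derive x 1 F (F' x))
  (cF' : forall x : R, 0 <= x -> {for x, continuous F'})
  (F'_ge0 : forall x : R, 0 <= x -> 0 <= F' x)
  (F_incr : forall x y : R, 0 <= x -> x < y -> F x < F y)
  (F_onto : forall x y : R, 0 <= x -> F 0 < y -> y <= F x -> J y)
  (psi_gt0 : forall y : R, J y -> 0 < psi y)
  (FK : forall y, J y -> F (psi y) = y).
Local Notation mu := (@lebesgue_measure R).

Let F_le x y : 0 <= x -> x <= y -> F x <= F y.
Proof.
by move=> x0; rewrite le_eqVlt => /predU1P[->//|/(F_incr _ _ x0)/ltW].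
Qed.

Let F_lt x y : 0 <= y -> F x < F y -> x < y.
Proof. by move=> y0; apply: contraTT; rewrite -!leNgt => /F_le; apply. Qed.

(** [F'] may be negative at negative arguments; cut off by 0 it is the density of a measure on the
    whole line. *)
Let f := (EFin \o F') \_ `]0, +oo[.

Let mf : measurable_fun setT f.
Proof.
apply: (iffLR (measurable_restrictT _ _)) => //.
by apply/measurable_EFinP; exact: measurable_funTS.
Qed.

Let f_ge0 x : (0 <= f x)%E.
Proof.
rewrite /f patchE; case: ifPn => //; rewrite inE/= in_itv/= andbT => /ltW x0.
by rewrite lee_fin F'_ge0.
Qed.

Let preimage_itvoc (a b : R) : 0 <= a -> a < b ->
  psi @^-1` `]a, b] `&` J = `]F a, F b]%classic.
Proof.
move=> a0 ab; have b0 := le_trans a0 (ltW ab).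
apply/seteqP; split => [y /= [+ Jy]|y /=]; rewrite !in_itv/= => /andP[ay yb].
  by rewrite -[y]FK// F_incr// F_le// ltW// psi_gt0.
have Jy : J y.
  by apply: (F_onto _ _ b0 _ yb); rewrite (le_lt_trans _ ay)// F_le.
split=> //; have psi0 := psi_gt0 _ Jy; apply/andP; split.
  by rewrite F_lt ?FK// ltW.
rewrite leNgt; apply/negP => /(F_incr _ _ b0); rewrite FK// => /lt_le_trans.
by move=> /(_ _ yb); rewrite ltxx.
Qed.

Let integral_itvoc (a b : R) : 0 <= a -> a < b ->
  (\int[mu]_(x in `]a, b]) (F' x)%:E = (F b - F a)%:E)%E.
Proof.
move=> a0 ab.
rewrite integral_itv_obnd_cbnd; last first.
  by apply/measurable_EFinP; exact: measurable_funTS.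
rewrite (@continuous_FTC2 _ F' F)//.
- apply: continuous_in_subspaceT => x; rewrite inE/= in_itv/= => /andP[ax _].
  by apply: cF'; exact: le_trans ax.
- split.
  + move=> x; rewrite in_itv/= => /andP[ax _].
    by have [] := dF _ (le_trans a0 (ltW ax)).
  + apply: cvg_at_right_filter; apply: differentiable_continuous.
    by apply/derivable1_diffP; have [] := dF _ a0.
  + apply: cvg_at_left_filter; apply: differentiable_continuous.
    by apply/derivable1_diffP; have [] := dF _ (le_trans a0 (ltW ab)).
- move=> x; rewrite in_itv/= => /andP[ax _].
  by rewrite derive1E; have [] := dF _ (le_trans a0 (ltW ax)).
Qed.

(* Both sides are measures in [A], compared on bounded intervals of the variable
   [x = psi y]: the fundamental theorem of calculus applies there without
   improper integrals. *)
Lemma lebesgue_measure_preimage (A : set R) : measurable A ->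
  mu (J `&` psi @^-1` A) = (\int[mu]_(x in A `&` `]0%R, +oo[) (F' x)%:E)%E.
Proof.
move=> mA; rewrite setIC integral_mkcondr.
(* [measurableTypeR R] is the real line with the sigma-algebra generated by half-open intervals, the
   form that the uniqueness argument below uses. *)
have mpsi' : @measurable_fun _ _ (measurableTypeR R) (measurableTypeR R)
  setT psi by exact: mpsi.
(* [m1] is the image under [psi] of Lebesgue measure restricted to [J]. *)
pose m1 : {measure set (measurableTypeR R) -> \bar R} :=
  measure_function_pushforward__canonical__measure_function_Measure
    (mrestr mu mJ) mpsi'.
pose m2 : {measure set (measurableTypeR R) -> \bar R} :=
    [the {measure set (measurableTypeR R) -> \bar R} of
      density_measure mu mf f_ge0].
have m12 (a b : R) : m1 `]a, b]%classic = m2 `]a, b]%classic /\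
    (m1 `]a, b]%classic < +oo)%E.
  rewrite /m1 /m2 /= /pushforward /mrestr/= /density_measure /f.
  rewrite -integral_mkcondr.
  (* Both measures are carried by the positive half line, [m1] because [psi] is positive on [J]; the
     left endpoint can thus be raised to 0. *)
  pose a' := Num.max a 0.
  have a'0 : 0 <= a' by rewrite /a' le_max lexx orbT.
  have -> : `]a, b] `&` `]0, +oo[ = `]a', b]%classic.
    apply/seteqP; split => x /=; rewrite !in_itv/= gt_max andbT.
      by move=> [/andP[-> ->] ->].
    by move=> /andP[/andP[-> ->] ->].
  have -> : psi @^-1` `]a, b] `&` J = psi @^-1` `]a', b] `&` J.
    apply/seteqP; split => x /= [+ Jx]; rewrite !in_itv/= gt_max psi_gt0//.
      by move=> /andP[-> ->].
    by rewrite andbT.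
  have [ab|ba] := ltP a' b; last first.
    rewrite set_itv_ge ?preimage_set0 ?set0I ?measure0 ?integral_set0 ?ltry//.
    by rewrite bnd_simp -leNgt.
  rewrite preimage_itvoc// integral_itvoc// lebesgue_measure_itv/= lte_fin.
  by rewrite F_incr// EFinB -EFinD ltry.
(* Half-open intervals are stable under intersection, generate the sigma-algebra and cover the line
   by sets of finite [m1] measure, hence determine the measure. *)
have g_cover : \bigcup_k `](- k%:R)%R, k%:R]%classic = [set: R].
  exact: bigcup_itvT.
have m12' X : ocitv X -> m1 X = m2 X by move=> [[a b] _ <-]; case: (m12 a b).
apply: (measure_unique (T := measurableTypeR R) (@ocitv R) _ erefl (@ocitvI R)
  _ g_cover m1 m2 m12' _ _ mA) => // k.
  exact: is_ocitv.
by case: (m12 (- k%:R) k%:R).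
Qed.

Lemma integral_substitution (h : R -> \bar R) :
    measurable_fun setT h -> (forall x, 0 <= h x)%E ->
  (\int[mu]_(y in J) h (psi y) =
   \int[mu]_(x in `]0%R, +oo[) (h x * (F' x)%:E))%E.
Proof.
apply: (@integral_comp_density _ _ (measurableTypeR R) (measurableTypeR R) R
  mu mu J psi `]0, +oo[%classic F') => //; try exact: measurable_funTS.
- by move=> x; rewrite /= in_itv/= andbT => /ltW /F'_ge0.
- exact: lebesgue_measure_preimage.
Qed.

End substitution.

(** * The two substitutions in use: scaling and odds *)

Section substitution_instances.
Context {R : realType}.
Local Notation mu := (@lebesgue_measure R).

(** Inversion is discontinuous at 0, where it has the default value 0. Written as x times the power
    -1 of x^2, it has a nonnegative base and a leading factor that gives 0 at 0, and real powers are
    known to be measurable. *)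
Lemma measurable_invr : measurable_fun [set: R] (@GRing.inv R).
Proof.
suff -> : @GRing.inv R = (fun x => x * (x ^+ 2) `^ (- 1)).
  apply: measurable_funM => //.
  have mX2 : measurable_fun [set: R] (fun x : R => x ^+ 2).
    exact: measurable_funX.
  exact: (measurableT_comp (@measurable_powR R (- 1)) mX2).
apply/funext => x; rewrite powR_inv1 ?sqr_ge0//.
have [->|x0] := eqVneq x 0; first by rewrite invr0 mul0r.
by rewrite expr2 invfM mulVKf.
Qed.

Lemma measurable_fun_inv {d : measure_display} {T : measurableType d}
    (f : T -> R) :
  measurable_fun setT f -> measurable_fun setT (fun x => (f x)^-1).
Proof. by move=> mf; exact: (measurableT_comp measurable_invr). Qed.

Lemma integral_scale (a : R) (h : R -> \bar R) : 0 < a ->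
    measurable_fun setT h -> (forall x, 0 <= h x)%E ->
  (\int[mu]_(x in `]0%R, +oo[) h x =
   \int[mu]_(x in `]0%R, +oo[) (h (a * x)%R * a%:E))%E.
Proof.
move=> a0 mh h0.
(* The test function is x |-> h (a x), which evaluated at y / a gives back h y. *)
rewrite -(@integral_substitution R (fun x => a * x) (fun=> a)
  (fun y => a^-1 * y) `]0, +oo[ _ _ _ _ _ _ _ _ _ _ (fun x => h (a * x)))//.
- by apply: eq_integral => x _; rewrite mulVKf// gt_eqF.
- exact: measurable_funM.
- move=> x _; rewrite -[X in is_derive _ _ _ X]mulr1.
  exact: is_deriveZ.
- by move=> x _; exact: cvg_cst.
- by move=> *; exact: ltW.
- by move=> x y _ xy; rewrite ltr_pM2l.
- by move=> x y _; rewrite mulr0 /= in_itv/= => ->.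
- by move=> y; rewrite /= in_itv/= andbT => y0; rewrite mulr_gt0// invr_gt0.
- by move=> y _; rewrite mulVKf// gt_eqF.
- by apply: measurableT_comp => //; exact: measurable_funM.
Qed.

Variables (c : R) (c0 : 0 < c).

Let den_gt0 (x : R) : 0 <= x -> 0 < c * x + 1.
Proof. by move=> x0; rewrite ltr_wpDl// mulr_ge0// ltW. Qed.

(** This is the substitution relating [M] to [Y]: the odds y / (c (1 - y)) invert x |-> c x / (c x +
    1), whose derivative is the factor on the right. *)
Lemma integral_odds (h : R -> \bar R) :
    measurable_fun setT h -> (forall x, 0 <= h x)%E ->
  (\int[mu]_(y in `]0%R, 1%R[) h (y / (c * (1 - y)))%R =
   \int[mu]_(x in `]0%R, +oo[) (h x * (c / (c * x + 1) ^+ 2)%:E))%E.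
Proof.
move=> mh h0.
apply: (@integral_substitution R (fun x => c * x / (c * x + 1))
  (fun x => c / (c * x + 1) ^+ 2) (fun y => y / (c * (1 - y)))) => //.
- apply: measurable_funM => //; apply: measurable_fun_inv.
  by apply: measurable_funM => //; exact: measurable_funB.
- apply: measurable_funM => //; apply: measurable_fun_inv.
  apply: measurable_funX; apply: measurable_funD => //.
- move=> x x0; have dx := den_gt0 _ x0.
  have d1 : is_derive x 1 (fun x => c * x) c.
    by rewrite -[X in is_derive _ _ _ X]mulr1; exact: is_deriveZ.
  have d2 : is_derive x 1 (fun x => c * x + 1) c.
    by rewrite -[X in is_derive _ _ _ X]addr0; exact: is_deriveD.
  have d3 := @is_deriveV _ (fun x => c * x + 1) x c 1 (lt0r_neq0 dx) d2.
  apply: (is_derive_eq (is_deriveM d1 d3)); rewrite /GRing.scale/=; field.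
  by rewrite gt_eqF.
- move=> x x0; have dx := den_gt0 _ x0.
  apply: cvgM; first exact: cvg_cst.
  apply: cvgV; first by rewrite sqrf_eq0 gt_eqF.
  have cx : (fun x => c * x + 1) @ x --> c * x + 1.
    apply: cvgD; last exact: cvg_cst.
    by apply: cvgM; [exact: cvg_cst|exact: cvg_id].
  exact: (cvgM cx cx).
- by move=> x x0; rewrite divr_ge0 ?sqr_ge0// ltW.
- move=> x y x0 xy; have y0 := le_trans x0 (ltW xy).
  rewrite ltr_pdivrMr ?den_gt0// mulrAC ltr_pdivlMr ?den_gt0//.
  rewrite -subr_gt0 (_ : _ - _ = c * (y - x)); last by ring.
  by rewrite mulr_gt0// subr_gt0.
- move=> x y x0; rewrite mulr0 mul0r /= in_itv/= => -> /le_lt_trans -> //.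
  by rewrite ltr_pdivrMr ?den_gt0// mul1r ltrDl.
- move=> y; rewrite /= in_itv/= => /andP[y0 y1].
  by rewrite divr_gt0// mulr_gt0// subr_gt0.
- move=> y; rewrite /= in_itv/= => /andP[y0 y1]; field.
  have : 1 - y != 0 by rewrite subr_eq0 gt_eqF.
  by move=> -> /=; rewrite (gt_eqF c0)//= addrC subrK oner_neq0.
Qed.

End substitution_instances.

(** * Densities tested on functions and on indicators *)

Section density_integral.
Context {R : realType} {d : measure_display} {T : measurableType d}.
Variables (P : probability T R) (X : T -> R) (D : set R).
Hypotheses (mX : measurable_fun setT X) (mD : measurable D).
Local Notation mu := (@lebesgue_measure R).
Local Open Scope ereal_scope.

Lemma has_density_integral (f : R -> R) (h : R -> \bar R) :
    has_density P X D f ->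
    measurable_fun setT h -> (forall x, 0 <= h x) ->
  \int[P]_t h (X t) = \int[mu]_(x in D) (h x * (f x)%:E).
Proof.
move=> [[mf f0 _] PX] mh h0.
apply: (@integral_comp_density _ _ _ (measurableTypeR R)) => // A mA.
by rewrite setTI; exact: PX.
Qed.

Lemma integral_indic_comp (A : set R) : measurable A ->
  \int[P]_t (\1_A (X t))%:E = P (X @^-1` A).
Proof.
move=> mA.
have mXA : measurable (X @^-1` A) by rewrite -[_ @^-1` _]setTI; exact: mX.
by rewrite -(setIT (X @^-1` A)) -(integral_indic P measurableT).
Qed.

(** Total mass 1 comes for free: it is the identity with [A] the whole line, [P] being a
    probability. *)
Lemma has_densityI (f : R -> R) :
    measurable_fun D f -> (forall x, D x -> 0 <= f x)%R ->
    (forall A, measurable A -> \int[P]_t (\1_A (X t))%:E =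
      \int[mu]_(x in D) ((\1_A x)%:E * (f x)%:E)) ->
  has_density P X D f.
Proof.
move=> mf f0 PX.
have PXA A : measurable A -> P (X @^-1` A) = \int[mu]_(x in A `&` D) (f x)%:E.
  move=> mA; rewrite -integral_indic_comp// PX// integral_mkcondl.
  by apply: eq_integral => x _; rewrite epatch_indic/= muleC.
split=> //; split=> //.
by have := PXA _ measurableT; rewrite preimage_setT setTI probability_setT.
Qed.

End density_integral.

(** * Exponential tilting of the Gamma law *)

Section gamma.
Context {R : realType} {d : measure_display} {T : measurableType d}.
Variables (P : probability T R) (G : {RV P >-> R}) (theta : R).
Hypothesis G_gamma : is_gamma theta P G.
Local Notation mu := (@lebesgue_measure R).

Lemma gamma_pdf_ge0 (x : R) : 0 <= gamma_pdf theta x.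
Proof.
rewrite /gamma_pdf divr_ge0 ?mulr_ge0 ?powR_ge0 ?expR_ge0//.
apply: fine_ge0; apply: integral_ge0 => y _.
by rewrite lee_fin mulr_ge0 ?powR_ge0 ?expR_ge0.
Qed.

Lemma measurable_gamma_pdf : measurable_fun [set: R] (gamma_pdf theta).
Proof.
apply: measurable_funM => //; apply: measurable_funM.
  exact: measurable_powR.
by apply: measurableT_comp => //; exact: measurable_funN.
Qed.

(** The powers of [a], with exponents - theta, theta - 1 and 1 (the Jacobian), cancel, so only the
    exponential feels the scaling. *)
Lemma gamma_pdfZ (a x : R) : 0 < a -> 0 < x ->
  a `^ (- theta) * gamma_pdf theta (a * x) * a =
  expR (- ((a - 1) * x)) * gamma_pdf theta x.
Proof.
move=> a0 x0; rewrite /gamma_pdf powRM ?ltW//.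
have -> : expR (- (a * x)) = expR (- ((a - 1) * x)) * expR (- x).
  by rewrite -expRD; congr expR; ring.
have aE : a `^ (- theta) * a `^ (theta - 1) * a = 1.
  rewrite -[X in _ * X](powRr1 (ltW a0)) -!powRD ?(gt_eqF a0) ?implybT//.
  by rewrite (_ : _ + _ = 0) ?powRr0//; ring.
rewrite -[RHS]mul1r -[X in _ = X * _]aE; ring.
Qed.

(** Scaling the variable by 1 + k in the right-hand integral removes the division inside [h], and
    [gamma_pdfZ] at a = 1 + k matches the densities. *)
Lemma gamma_integral_scale (k : R) (h : R -> \bar R) : 0 <= k ->
    measurable_fun setT h -> (forall x, 0 <= h x)%E ->
  (\int[P]_t ((expR (- (k * G t)))%:E * h (G t)) =
   ((1 + k) `^ (- theta))%:E * \int[P]_t h (G t / (1 + k))%R)%E.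
Proof.
move=> k0 mh h0.
have a0 : 0 < 1 + k by rewrite ltr_pwDl.
set a := 1 + k in a0 *.
have mG : measurable_fun setT G by [].
rewrite (has_density_integral _ _ _ mG _ _
  (fun x => (expR (- (k * x)))%:E * h x)%E G_gamma)//; last 2 first.
- apply: emeasurable_funM => //; apply/measurable_EFinP.
  apply: measurableT_comp => //; apply: measurable_funN.
  exact: measurable_funM.
- by move=> x; rewrite mule_ge0// lee_fin expR_ge0.
have mha : measurable_fun [set: R] (fun x => h (x / a)).
  by apply: measurableT_comp => //; exact: measurable_funM.
rewrite (has_density_integral _ _ _ mG _ _ (fun x => h (x / a)) G_gamma)//.
have mhg : measurable_fun [set: R]
    (fun x => (h (x / a)%R * (gamma_pdf theta x)%:E)%E).
  apply: emeasurable_funM => //; apply/measurable_EFinP.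
  exact: measurable_gamma_pdf.
have hg0 (x : R) : (0 <= h (x / a)%R * (gamma_pdf theta x)%:E)%E.
  by rewrite mule_ge0// lee_fin gamma_pdf_ge0.
rewrite (integral_scale a (fun x => h (x / a)%R * (gamma_pdf theta x)%:E)%E)//.
rewrite -ge0_integralZl//; last 3 first.
- apply: measurable_funTS; apply: emeasurable_funM => //.
  apply: (measurableT_comp mhg); exact: measurable_funM.
- by move=> x _; rewrite mule_ge0// lee_fin ltW.
- by rewrite lee_fin powR_ge0.
apply: eq_integral => x; rewrite inE/= in_itv/= andbT => x0.
rewrite mulrAC divff ?gt_eqF// mul1r.
have := gamma_pdfZ a x a0 x0; rewrite (_ : a - 1 = k); last first.
  by rewrite /a addrC addKr.
move=> gammaE; transitivity (h x * (expR (- (k * x)) * gamma_pdf theta x)%:E)%E.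
  by rewrite [in RHS]EFinM [RHS]muleCA [RHS]muleA.
rewrite -gammaE (EFinM (_ * _) a) EFinM [RHS]muleA.
by rewrite [in RHS](muleCA _ (h x)) -[RHS]muleA.
Qed.

End gamma.

(** * The tilting identity for the pair (G, M) and its normalising constant *)

Section tilting.
Context {R : realType} {d : measure_display} {T : measurableType d}.
Variables (P : probability T R) (G M : {RV P >-> R}) (theta : R).
Hypotheses (M_pos : {ae P, forall t, 0 < M t})
  (indep_GM : independent_RVs P G M) (G_gamma : is_gamma theta P G).
Local Notation mu := (@lebesgue_measure R).

Let mG : measurable_fun setT G. Proof. by []. Qed.
Let mM : measurable_fun setT M. Proof. by []. Qed.

Section fixed_c.
Variables (c : R) (c0 : 0 < c).

Let mweight : measurable_fun [set: R] (fun m => (1 + c * m) `^ (- theta)).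
Proof.
apply: (measurableT_comp (@measurable_powR R (- theta))).
by apply: measurable_funD => //; exact: measurable_funM.
Qed.

Let mratio : measurable_fun [set: R] (fun m => c * m / (c * m + 1)).
Proof.
have mcM : measurable_fun [set: R] (fun m => c * m) by exact: measurable_funM.
apply: measurable_funM => //; apply: measurable_fun_inv.
exact: measurable_funD.
Qed.

(** Independence turns both sides into iterated integrals with [M] outermost. The inner ones agree
    by [gamma_integral_scale] at k = c m, which is known to be nonnegative only for almost every
    value of [M]; hence the almost-everywhere comparison of the outer integrands. *)
Lemma expR_tilt (h : R * R -> \bar R) :
    measurable_fun setT h -> (forall x, 0 <= h x)%E ->
  (\int[P]_t ((expR (- (c * (G t * M t))))%:E * h (G t, M t)) =
   \int[P]_t (((1 + c * M t) `^ (- theta))%:E *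
              h (G t / (1 + c * M t), M t)%R))%E.
Proof.
move=> mh h0.
have mcM : measurable_fun [set: R * R] (fun x => c * x.2).
  by apply: measurable_funM => //; exact: measurable_snd.
pose h1 (x : R * R) := ((expR (- (c * (x.1 * x.2))))%:E * h x)%E.
pose h2 (x : R * R) := (((1 + c * x.2) `^ (- theta))%:E *
  h (x.1 / (1 + c * x.2), x.2)%R)%E.
have mh1 : measurable_fun setT h1.
  apply: emeasurable_funM => //; apply/measurable_EFinP.
  apply: measurableT_comp => //; apply: measurable_funN.
  by apply: measurable_funM => //; exact: measurable_funM.
have mh2 : measurable_fun setT h2.
  apply: emeasurable_funM.
    apply/measurable_EFinP; apply: (measurableT_comp mweight).
    exact: measurable_snd.
  apply: measurableT_comp => //; apply: measurable_fun_pair => //.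
  apply: measurable_funM => //; apply: measurable_fun_inv.
  exact: measurable_funD.
have h10 x : (0 <= h1 x)%E by rewrite mule_ge0// lee_fin expR_ge0.
have h20 x : (0 <= h2 x)%E by rewrite mule_ge0// lee_fin powR_ge0.
transitivity (\int[P]_t \int[P]_s h1 (G s, M t))%E.
  exact: (independent_integral P G M h1).
transitivity (\int[P]_t \int[P]_s h2 (G s, M t))%E; last first.
  by apply/esym; exact: (independent_integral P G M h2).
apply: ge0_ae_eq_integral => //.
- exact: (measurableT_comp (measurable_integral_fst P G h1 mh1 h10)).
- exact: (measurableT_comp (measurable_integral_fst P G h2 mh2 h20)).
- by move=> t _; exact: integral_ge0.
- by move=> t _; exact: integral_ge0.
apply: filterS M_pos => t Mt0 _.
have mht : measurable_fun setT (fun g : R => h (g, M t)).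
  exact: measurableT_comp.
rewrite /h1 /h2 /= ge0_integralZl//; last 2 first.
- apply: (measurableT_comp mht); exact: measurable_funM.
- by rewrite lee_fin powR_ge0.
rewrite -(gamma_integral_scale P G theta G_gamma (c * M t)
  (fun g => h (g, M t)))//.
- by apply: eq_integral => s _; rewrite mulrA mulrAC.
- by rewrite mulr_ge0// ltW.
Qed.

Lemma power_moment_laplace : power_moment P theta M c = laplace_GM P G M c.
Proof.
rewrite /power_moment /laplace_GM unlock.
have := expR_tilt (cst 1%E) (measurable_cst _) (fun=> lee01).
by under eq_integral do rewrite mule1; under [RHS]eq_integral do rewrite mule1.
Qed.

Let mweightM : measurable_fun [set: T] (fun t => (1 + c * M t) `^ (- theta)).
Proof. exact: (measurableT_comp mweight mM). Qed.

(** The base 1 + c M is almost surely at least 1 and the exponent is at most 0. The bound makes the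
    moment finite, so that [fine] keeps its value. *)
Lemma power_moment_le1 : 0 <= theta -> (power_moment P theta M c <= 1)%E.
Proof.
move=> theta0; rewrite /power_moment unlock.
rewrite -[leRHS](probability_setT P) -[leRHS]mul1e -integral_cst//.
apply: ae_ge0_le_integral => //.
- by move=> t _; rewrite lee_fin powR_ge0.
- exact/measurable_EFinP.
- apply: filterS M_pos => t Mt0 _.
  rewrite lee_fin -[leRHS](powRr0 (1 + c * M t)) ler_powR// ?oppr_le0//.
  by rewrite lerDl mulr_ge0// ltW.
Qed.

(** A nonnegative integrand with zero integral vanishes almost everywhere, but this one is positive
    wherever [M] is; together these would make the whole space null. *)
Lemma power_moment_gt0 : (0 < power_moment P theta M c)%E.
Proof.
rewrite /power_moment unlock lt_neqAle integral_ge0 ?andbT; last first.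
  by move=> t _; rewrite lee_fin powR_ge0.
apply/eqP => /esym int0.
have : ae_eq P setT (fun t => ((1 + c * M t) `^ (- theta))%:E) (cst 0%E).
  apply/ae_eq_integral_abs => //; first exact/measurable_EFinP.
  rewrite -[RHS]int0; apply: eq_integral => t _.
  by rewrite gee0_abs// lee_fin powR_ge0.
move=> w0; have : {ae P, forall t, False}.
  apply: filterS2 w0 M_pos => t + Mt0 => /(_ I) [] /eqP.
  by rewrite gt_eqF// powR_gt0// addr_gt0// mulr_gt0.
case=> A [mA PA0 TA]; have := probability_setT P.
have -> : [set: T] = A.
  by apply/seteqP; split => // t _; apply: TA => /=; exact.
by rewrite PA0 => /esym/eqP; rewrite onee_eq0.
Qed.

(** * The tilted laws as integrals against the normalised weight [w (M t)] *)

Hypothesis theta0 : 0 <= theta.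
Local Notation N := (fine (power_moment P theta M c)).
Local Notation w m := ((1 + c * m) `^ (- theta) / N).
Local Notation Y := (ratio_transform c M).

Let NE : power_moment P theta M c = N%:E.
Proof.
rewrite fineK// ge0_fin_numE; last exact/ltW/power_moment_gt0.
by rewrite (le_lt_trans (power_moment_le1 theta0)) ?ltry.
Qed.

Let N_gt0 : 0 < N.
Proof. by rewrite -lte_fin -NE power_moment_gt0. Qed.

Let w_ge0 (m : R) : 0 <= w m.
Proof. by rewrite divr_ge0 ?powR_ge0// ltW. Qed.

Let mw : measurable_fun [set: R] (fun m => w m).
Proof. exact: measurable_funM. Qed.

Let mwM : measurable_fun [set: T] (fun t => w (M t)).
Proof. exact: (measurableT_comp mw mM). Qed.

Lemma measurable_ratio_transform : measurable_fun setT Y.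
Proof. exact: (measurableT_comp mratio mM). Qed.

Lemma integral_weight : (\int[P]_t (w (M t))%:E = 1)%E.
Proof.
under eq_integral do rewrite mulrC EFinM.
rewrite ge0_integralZl//; last 3 first.
- exact/measurable_EFinP.
- by move=> t _; rewrite lee_fin powR_ge0.
- by rewrite lee_fin invr_ge0 ltW.
have := NE; rewrite {1}/power_moment unlock => ->.
by rewrite -EFinM mulVf// gt_eqF.
Qed.

Let onem_ratio_powR (m : R) : 0 < m ->
  (1 - c * m / (c * m + 1)) `^ theta = (1 + c * m) `^ (- theta).
Proof.
move=> m0; have cm0 : 0 < c * m + 1 by rewrite addr_gt0// mulr_gt0.
have -> : 1 - c * m / (c * m + 1) = (1 + c * m)^-1.
  rewrite [1 + c * m]addrC -[X in X - _](divff (lt0r_neq0 cm0)) -mulrBl.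
  by rewrite addrAC subrr add0r mul1r.
by rewrite -powR_inv1 -?powRrM ?mulN1r// addrC ltW.
Qed.

(** The factor (1 - y)^theta is first moved into the test function, leaving the density of [Y]
    alone, and then becomes the weight wherever [M] is positive. The right-hand side is free of
    [fY], and the tilted laws of [W] and [M] are brought to the same weight below. *)
Lemma Y_theta_c_pdf_integral (fY : R -> R) (h : R -> \bar R) :
    has_density P Y `]0, 1[ fY ->
    measurable_fun setT h -> (forall x, 0 <= h x)%E ->
  (\int[mu]_(y in `]0%R, 1%R[) (h y * (Y_theta_c_pdf P theta M c fY y)%:E) =
   \int[P]_t ((w (M t))%:E * h (Y t)))%E.
Proof.
move=> YfY mh h0.
pose h1 (y : R) := (h y * ((1 - y) `^ theta / N)%:E)%E.
have mp : measurable_fun [set: R] (fun y => (1 - y) `^ theta / N).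
  apply: measurable_funM => //.
  apply: (measurableT_comp (@measurable_powR R theta)).
  exact: measurable_funB.
have mh1 : measurable_fun setT h1.
  by apply: emeasurable_funM => //; exact/measurable_EFinP.
have h10 y : (0 <= h1 y)%E.
  by rewrite mule_ge0// lee_fin divr_ge0 ?powR_ge0// ltW.
transitivity (\int[P]_t h1 (Y t))%E.
  rewrite (has_density_integral P Y _ measurable_ratio_transform _ fY h1 YfY)//.
  apply: eq_integral => y _; rewrite /h1 /Y_theta_c_pdf -muleA -EFinM.
  by congr (_ * _%:E)%E; ring.
apply: ge0_ae_eq_integral => //.
- exact: (measurableT_comp mh1 measurable_ratio_transform).
- apply: emeasurable_funM; first exact/measurable_EFinP.
  exact: (measurableT_comp mh measurable_ratio_transform).
- by move=> t _; rewrite mule_ge0// lee_fin.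
apply: filterS M_pos => t Mt0 _.
by rewrite /h1 /ratio_transform muleC onem_ratio_powR.
Qed.

(** The density at y is [fM] at the odds m = y / (c (1 - y)), divided by the derivative c / (c m +
    1)^2 of the ratio map there. *)
Lemma ratio_transform_density (fM : R -> R) :
  has_density P M `]0, +oo[ fM ->
  exists fY : R -> R, has_density P Y `]0, 1[ fY.
Proof.
move=> Mf; have [[mfM fM0 _] _] := Mf.
(* Nothing is known of [fM] off the half line; extended by 0 it is measurable and nonnegative
   everywhere, as the substitution requires. *)
pose f := fM \_ `]0, +oo[.
have mf : measurable_fun setT f by exact: (iffLR (measurable_restrictT _ _)).
have f0 (x : R) : 0 <= f x.
  by rewrite /f patchE; case: ifPn => //; rewrite inE => /fM0.
pose k (x : R) := f x / (c / (c * x + 1) ^+ 2).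
have mk : measurable_fun setT k.
  apply: measurable_funM => //; apply: measurable_fun_inv.
  apply: measurable_funM => //; apply: measurable_fun_inv.
  apply: measurable_funX; exact: measurable_funD.
have k0 x : 0 <= k x.
  by rewrite divr_ge0// divr_ge0 ?sqr_ge0// ltW.
pose odds (y : R) := y / (c * (1 - y)).
have modds : measurable_fun setT odds.
  apply: measurable_funM => //; apply: measurable_fun_inv.
  by apply: measurable_funM => //; exact: measurable_funB.
exists (fun y => k (odds y)); apply: has_densityI => //.
- exact: measurable_ratio_transform.
- by apply: measurable_funTS; exact: (measurableT_comp mk modds).
move=> A mA.
have mindic : measurable_fun setT (EFin \o (\1_A : R -> R)).
  by apply/measurable_EFinP; exact: measurable_indic.
pose h (x : R) := (\1_A (c * x / (c * x + 1)) : R)%:E.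
have mh : measurable_fun setT h by exact: (measurableT_comp mindic mratio).
have h0 x : (0 <= h x)%E by rewrite lee_fin.
transitivity (\int[mu]_(x in `]0%R, +oo[) (h x * (fM x)%:E))%E.
  by rewrite -(has_density_integral P M _ mM _ fM h Mf).
transitivity (\int[mu]_(x in `]0%R, +oo[)
    ((h x * (k x)%:E) * (c / (c * x + 1) ^+ 2)%:E))%E.
  apply: eq_integral => x xD; move: (xD); rewrite inE/= in_itv/= andbT => x0.
  rewrite -muleA -(EFinM (k x)) /k divfK; first by rewrite /f patchE xD.
  by rewrite mulf_neq0 ?invr_eq0 ?gt_eqF// exprn_gt0// addr_gt0// mulr_gt0.
rewrite -(integral_odds c c0 (fun x => h x * (k x)%:E)%E); last 2 first.
- by apply: emeasurable_funM => //; exact/measurable_EFinP.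
- by move=> x; rewrite mule_ge0// lee_fin.
apply: eq_integral => y; rewrite inE/= in_itv/= => /andP[y0 y1].
rewrite /h (_ : c * _ / _ = y)//; field.
have : 1 - y != 0 by rewrite subr_eq0 gt_eqF.
by move=> -> /=; rewrite (gt_eqF c0)//= addrC subrK oner_neq0.
Qed.

(** The weighted integral does not mention [fY], so it recognises the law of Y_{theta,c} whichever
    version of the density of [Y] is at hand. *)
Lemma Y_theta_c_density_iff {d' : measure_display} {T' : measurableType d'}
    (P' : probability T' R) (Y' : {RV P' >-> R}) (fY : R -> R) :
    has_density P Y `]0, 1[ fY ->
  has_density P' Y' `]0, 1[ (Y_theta_c_pdf P theta M c fY) <->
  forall A, measurable A ->
    P' (Y' @^-1` A) = (\int[P]_t ((w (M t))%:E * (\1_A (Y t))%:E))%E.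
Proof.
move=> YfY; have [[mfY fY0 _] _] := YfY.
have mY' : measurable_fun setT Y' by [].
have pdfE A : measurable A ->
    (\int[mu]_(y in `]0%R, 1%R[)
      ((\1_A y)%:E * (Y_theta_c_pdf P theta M c fY y)%:E) =
    \int[P]_t ((w (M t))%:E * (\1_A (Y t))%:E))%E.
  move=> mA; apply: (Y_theta_c_pdf_integral fY (fun y => (\1_A y)%:E)) => //.
  by apply/measurable_EFinP; exact: measurable_indic.
split=> [Y'd A mA|Y'E].
  rewrite -pdfE// -(integral_indic_comp P' Y' mY')//.
  apply: (has_density_integral P' Y' _ mY' _ _ (fun y => (\1_A y)%:E)) => //.
  by apply/measurable_EFinP; exact: measurable_indic.
apply: has_densityI => //.
- apply: measurable_funM => //; apply: measurable_funM => //.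
  apply: measurable_funTS.
  apply: (measurableT_comp (@measurable_powR R theta)).
  exact: measurable_funB.
- move=> y yD; rewrite /Y_theta_c_pdf divr_ge0 ?mulr_ge0 ?powR_ge0 ?fY0//.
  exact: ltW.
- by move=> A mA; rewrite pdfE// -Y'E// integral_indic_comp.
Qed.

(** Scaling by [b] turns the left side into the expectation of exp(-c G M) h(b G M) / N. Then
    [expR_tilt] replaces G by G / (1 + c M), and b G M / (1 + c M) = (b / c) G Y. *)
Lemma Wtilde_pdf_integral (b : R) (fW : R -> R) (h : R -> \bar R) : 0 < b ->
    has_density P (fun t => G t * M t) `]0, +oo[ fW ->
    measurable_fun setT h -> (forall x, 0 <= h x)%E ->
  (\int[mu]_(x in `]0%R, +oo[) (h x * (Wtilde_pdf P G M b c fW x)%:E) =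
   \int[P]_t ((w (M t))%:E * h (b / c * G t * Y t)%R))%E.
Proof.
move=> b0 Wf mh h0; have [[mfW fW0 _] _] := Wf.
pose f := fW \_ `]0, +oo[.
have mf : measurable_fun setT f by exact: (iffLR (measurable_restrictT _ _)).
have f0 (x : R) : 0 <= f x.
  by rewrite /f patchE; case: ifPn => //; rewrite inE => /fW0.
pose p (x : R) := expR (- (c / b * x)) * (b^-1 * f (x / b)) / N.
have mp : measurable_fun setT p.
  apply: measurable_funM => //; apply: measurable_funM.
    apply: measurableT_comp => //; apply: measurable_funN.
    exact: measurable_funM.
  apply: measurable_funM => //; apply: (measurableT_comp mf).
  exact: measurable_funM.
have p0 x : 0 <= p x.
  rewrite divr_ge0 ?(ltW N_gt0)// mulr_ge0 ?expR_ge0// mulr_ge0//.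
  by rewrite invr_ge0 ltW.
have mbx : measurable_fun [set: R] (fun x => b * x) by exact: measurable_funM.
have mhb : measurable_fun [set: R] (fun x => h (b * x)).
  exact: (measurableT_comp mh mbx).
transitivity (\int[mu]_(x in `]0%R, +oo[) (h x * (p x)%:E))%E.
  apply: eq_integral => x; rewrite inE/= in_itv/= andbT => x0.
  congr (_ * _%:E)%E.
  rewrite /Wtilde_pdf -power_moment_laplace /p /f patchE ifT//.
  by rewrite inE/= in_itv/= andbT divr_gt0.
rewrite (integral_scale b (fun x => h x * (p x)%:E)%E)//; last 2 first.
- by apply: emeasurable_funM => //; exact/measurable_EFinP.
- by move=> x; rewrite mule_ge0// lee_fin.
pose k (x : R) := ((expR (- (c * x)))%:E * (N^-1%:E * h (b * x)%R))%E.
have mk : measurable_fun setT k.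
  apply: emeasurable_funM; last exact: measurable_funeM.
  apply/measurable_EFinP; apply: measurableT_comp => //.
  by apply: measurable_funN; exact: measurable_funM.
have k0 x : (0 <= k x)%E.
  by rewrite !mule_ge0// lee_fin ?expR_ge0// invr_ge0 ltW.
transitivity (\int[mu]_(x in `]0%R, +oo[) (k x * (fW x)%:E))%E.
  apply: eq_integral => x xD; rewrite /k /p [b * x / b]mulrAC divff ?gt_eqF//.
  rewrite mul1r {1}/f patchE xD muleA (muleC _ (h (b * x)%R)) -!muleA.
  congr (_ * _)%E; rewrite -!EFinM; congr EFin.
  rewrite (_ : c / b * (b * x) = c * x); last by field; rewrite gt_eqF.
  by field; rewrite !gt_eqF.
have mW : measurable_fun setT (fun t => G t * M t) by exact: measurable_funM.
rewrite -(has_density_integral P _ _ mW _ fW k Wf)//.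
pose H (x : R * R) := (N^-1%:E * h (b * (x.1 * x.2))%R)%E.
have mH : measurable_fun setT H.
  apply: measurable_funeM; apply: (measurableT_comp mhb).
  exact: measurable_funM.
have H0 x : (0 <= H x)%E by rewrite mule_ge0// lee_fin invr_ge0 ltW.
rewrite [LHS](expR_tilt H mH H0).
apply: eq_integral => t _; rewrite /H /= muleA -EFinM; congr (_ * h _)%E.
(* The sign of [M t] is not known at this t, so [u] hides the inverse of c M + 1 and [field] has
   only [c] to invert. *)
rewrite /ratio_transform [1 + _]addrC; set u := (_ + _)^-1.
by field; rewrite gt_eqF.
Qed.

Lemma M_tilted_pdf_integral (fM : R -> R) (h : R -> \bar R) :
    has_density P M `]0, +oo[ fM ->
    measurable_fun setT h -> (forall x, 0 <= h x)%E ->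
  (\int[mu]_(x in `]0%R, +oo[) (h x * (M_tilted_pdf P theta G M c fM x)%:E) =
   \int[P]_t ((w (M t))%:E * h (M t)))%E.
Proof.
move=> Mf mh h0.
pose k (m : R) := ((w m)%:E * h m)%E.
have mk : measurable_fun setT k.
  by apply: emeasurable_funM => //; exact/measurable_EFinP.
have k0 x : (0 <= k x)%E by rewrite mule_ge0// lee_fin.
rewrite [RHS](has_density_integral P M _ mM _ fM k Mf)//.
apply: eq_integral => x _; rewrite /k [in RHS](muleC _ (h x)) -muleA -EFinM.
rewrite /M_tilted_pdf -power_moment_laplace [c * x + 1]addrC.
by congr (_ * _%:E)%E; ring.
Qed.

(** * A probability under which Y has the law of Y_{theta,c} *)

Let mEw : measurable_fun [set: T] (fun t => (w (M t))%:E).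
Proof. exact/measurable_EFinP. Qed.

Let Ew_ge0 t : (0 <= (w (M t))%:E)%E.
Proof. by rewrite lee_fin. Qed.

Let tilted_setT : density_measure P mEw Ew_ge0 setT = 1%E.
Proof. exact: integral_weight. Qed.

(* Under the law of density [w (M t)] with respect to [P], the variable [G] is
   still Gamma(theta) and independent of [M], since the density only involves
   [M]. *)
Lemma exists_tilted_probability (fY : R -> R) : has_density P Y `]0, 1[ fY ->
  exists (Q : probability T R) (Y' : {RV Q >-> R}),
    [/\ is_gamma theta Q G,
        has_density Q Y' `]0, 1[ (Y_theta_c_pdf P theta M c fY) &
        independent_RVs Q G Y'].
Proof.
move=> YfY.
pose Q : probability T R := HB.pack (density_measure P mEw Ew_ge0)
  (Measure_isProbability.Build _ _ _ (density_measure P mEw Ew_ge0)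
    tilted_setT).
have QE A : measurable A -> Q A = (\int[P]_t ((w (M t))%:E * (\1_A t)%:E))%E.
  move=> mA; rewrite /Q/= /density_measure integral_mkcond.
  by apply: eq_integral => t _; rewrite epatch_indic.
pose Y' : {RV Q >-> R} := HB.pack Y
  (isMeasurableFun.Build _ _ _ _ Y measurable_ratio_transform).
have mpre (X : T -> R) A : measurable_fun setT X -> measurable A ->
    measurable (X @^-1` A).
  by move=> mX mA; rewrite -[_ @^-1` _]setTI; exact: mX.
(* With [B] the whole line this says that [G] has the same law under [Q] as under [P]; substituted
   back, it becomes independence under [Q]. *)
have QGY A B : measurable A -> measurable B ->
    Q (G @^-1` A `&` Y @^-1` B) = (P (G @^-1` A) * Q (Y @^-1` B))%E.
  move=> mA mB.
  have mYB := mpre _ _ measurable_ratio_transform mB.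
  rewrite QE; last by apply: measurableI => //; exact: mpre.
  rewrite QE// -(integral_indic_comp P G mG)//.
  pose phi (x : R) := (\1_A x : R)%:E.
  pose psi (x : R) := ((w x)%:E * (\1_B (c * x / (c * x + 1)))%:E)%E.
  transitivity (\int[P]_t (phi (G t) * psi (M t)))%E.
    apply: eq_integral => t _; rewrite /phi /psi muleCA; congr (_ * _)%E.
    by rewrite -EFinM !indicE in_setI -natrM mulnb.
  rewrite (independent_integralM P G M phi psi indep_GM)//.
  - by apply/measurable_EFinP; exact: measurable_indic.
  - by move=> x; rewrite lee_fin.
  - apply: emeasurable_funM; first exact/measurable_EFinP.
    apply/measurable_EFinP; apply: (measurableT_comp _ mratio).
    exact: measurable_indic.
  - by move=> x; rewrite mule_ge0// lee_fin.
have QG A : measurable A -> Q (G @^-1` A) = P (G @^-1` A).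
  move=> mA; have := QGY _ _ mA measurableT.
  by rewrite preimage_setT setIT probability_setT mule1.
exists Q, Y'; split.
- have [pdfG PG] := G_gamma; split=> // A mA; rewrite -PG//; exact: QG.
- apply/(Y_theta_c_density_iff _ _ _ YfY) => A mA; rewrite QE//.
  exact: mpre measurable_ratio_transform mA.
- move=> A B mA mB; rewrite QGY//; congr (_ * _)%E; exact/esym/QG.
Qed.

(** * Tilted densities are densities, and the resulting identities in law *)

Let itv0y_gt0 (x : R) : `]0, +oo[%classic x -> 0 < x.
Proof. by rewrite /= in_itv/= andbT. Qed.

Lemma is_pdf_Wtilde (b : R) (fW : R -> R) : 0 < b ->
  has_density P (fun t => G t * M t) `]0, +oo[ fW ->
  is_pdf `]0, +oo[ (Wtilde_pdf P G M b c fW).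
Proof.
move=> b0 Wf; have [[mfW fW0 _] _] := Wf.
have Db (x : R) : `]0, +oo[%classic x -> `]0, +oo[%classic (x / b).
  by move=> /itv0y_gt0 x0; rewrite /= in_itv/= andbT divr_gt0.
split.
- apply: measurable_funM => //; apply: measurable_funM.
    apply: measurableT_comp => //; apply: measurable_funN.
    exact: measurable_funM.
  apply: measurable_funM => //.
  have divD : [set x / b | x in `]0, +oo[] `<=` `]0, +oo[%classic.
    by move=> _ [x /Db ? <-].
  have mdiv : measurable_fun (`]0, +oo[%classic : set R) (fun x : R => x / b).
    exact: measurable_funM.
  by apply: (measurable_comp _ divD mfW mdiv).
- move=> x xD; rewrite /Wtilde_pdf -power_moment_laplace.
  rewrite divr_ge0 ?(ltW N_gt0)// mulr_ge0 ?expR_ge0//.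
  rewrite mulr_ge0 ?invr_ge0 ?(ltW b0)//.
  exact/fW0/Db.
- have := Wtilde_pdf_integral b fW (cst 1%E) b0 Wf (measurable_cst _)
    (fun=> lee01).
  under eq_integral do rewrite mul1e; move=> ->.
  by under eq_integral do rewrite mule1; exact: integral_weight.
Qed.

Lemma is_pdf_M_tilted (fM : R -> R) : has_density P M `]0, +oo[ fM ->
  is_pdf `]0, +oo[ (M_tilted_pdf P theta G M c fM).
Proof.
move=> Mf; have [[mfM fM0 _] _] := Mf.
split.
- apply: measurable_funM => //; apply: measurable_funM => //.
  apply: measurable_funTS.
  apply: (measurableT_comp (@measurable_powR R (- theta))).
  by apply: measurable_funD => //; exact: measurable_funM.
- move=> x xD; rewrite /M_tilted_pdf -power_moment_laplace.
  by rewrite divr_ge0 ?(ltW N_gt0)// mulr_ge0 ?powR_ge0 ?fM0.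
- have := M_tilted_pdf_integral fM (cst 1%E) Mf (measurable_cst _)
    (fun=> lee01).
  under eq_integral do rewrite mul1e; move=> ->.
  by under eq_integral do rewrite mule1; exact: integral_weight.
Qed.

(** Both laws are brought back to [P] as integrals of the weight in [M] times a function of [G] and
    [Y]: the left one by [Wtilde_pdf_integral], the right one by integrating out [G2], then [Y2].
    Independence of [G] and [M] identifies the two. *)
Lemma Wtilde_eq_in_distribution (b : R) (fW : R -> R)
    {d1 : measure_display} {T1 : measurableType d1} (P1 : probability T1 R)
    (Wt : {RV P1 >-> R})
    {d2 : measure_display} {T2 : measurableType d2} (P2 : probability T2 R)
    (G2 Y2 : {RV P2 >-> R}) : 0 < b ->
    has_density P (fun t => G t * M t) `]0, +oo[ fW ->
    has_density P1 Wt `]0, +oo[ (Wtilde_pdf P G M b c fW) ->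
    is_gamma theta P2 G2 -> is_Y_theta_c P theta M c P2 Y2 ->
    independent_RVs P2 G2 Y2 ->
  eq_in_distribution P1 Wt P2 (fun t => b / c * G2 t * Y2 t).
Proof.
move=> b0 Wf Wtd G2g [fY YfY Y2d] indep2 A mA.
have mWt : measurable_fun setT Wt by [].
have mG2 : measurable_fun setT G2 by [].
have mY2 : measurable_fun setT Y2 by [].
pose I (x : R) := (\1_A x : R)%:E.
have mI : measurable_fun setT I.
  by apply/measurable_EFinP; exact: measurable_indic.
have I0 x : (0 <= I x)%E by rewrite lee_fin.
have mbcx : measurable_fun [set: R * R] (fun x => b / c * x.1 * x.2).
  by apply: measurable_funM => //; exact: measurable_funM.
have mGY2 : measurable_fun setT (fun t => b / c * G2 t * Y2 t).
  by apply: measurable_funM => //; exact: measurable_funM.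
rewrite -(integral_indic_comp P1 Wt mWt)// -(integral_indic_comp P2 _ mGY2)//.
rewrite [LHS](has_density_integral P1 Wt _ mWt _ _ I Wtd)//.
rewrite (Wtilde_pdf_integral b fW I b0 Wf)//.
pose h (x : R * R) := I (b / c * x.1 * x.2).
have mh : measurable_fun setT h by exact: (measurableT_comp mI mbcx).
have h0 x : (0 <= h x)%E by exact: I0.
(* [H] integrates out the Gamma factor under [P]; as [G2] has the same density as [G], it is also
   the inner integral under [P2]. *)
pose H (y : R) := (\int[P]_s h (G s, y))%E.
have mH : measurable_fun setT H by exact: measurable_integral_fst.
have H0 y : (0 <= H y)%E by exact: integral_ge0.
transitivity (\int[P2]_t H (Y2 t))%E; last first.
  transitivity (\int[P2]_t \int[P2]_s h (G2 s, Y2 t))%E; last first.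
    by apply/esym; exact: (independent_integral P2 G2 Y2 h).
  apply: eq_integral => t _.
  have mht : measurable_fun setT (fun g : R => h (g, Y2 t)).
    exact: measurableT_comp.
  rewrite (has_density_integral P2 G2 _ mG2 _ _ (fun g => h (g, Y2 t)) G2g)//.
  by rewrite -(has_density_integral P G _ mG _ _ (fun g => h (g, Y2 t))
    G_gamma).
rewrite (has_density_integral P2 Y2 _ mY2 _ _ H Y2d)//.
rewrite (Y_theta_c_pdf_integral fY H YfY mH H0).
(* The weight depends on [M] only, so it can be included in the function of the pair and pulled out
   of the inner integral over [G]. *)
pose k (x : R * R) := ((w x.2)%:E * h (x.1, c * x.2 / (c * x.2 + 1))%R)%E.
have mk : measurable_fun setT k.
  apply: emeasurable_funM.
    apply/measurable_EFinP; apply: (measurableT_comp mw).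
    exact: measurable_snd.
  apply: (measurableT_comp mh); apply: measurable_fun_pair => //.
  by apply: (measurableT_comp mratio); exact: measurable_snd.
have k0 x : (0 <= k x)%E by rewrite mule_ge0// lee_fin.
transitivity (\int[P]_t \int[P]_s k (G s, M t))%E.
  exact: (independent_integral P G M k).
apply: eq_integral => t _; rewrite /k /= ge0_integralZl ?lee_fin//.
apply: (@measurableT_comp _ _ _ _ _ _ (fun g : R => h (g, Y t))) => //.
exact: measurableT_comp.
Qed.

(** The ratio transform of [M1] has the weighted integrals that characterise Y_{theta,c}. In the
    backward direction no density of [Y] is given; [ratio_transform_density] supplies it. *)
Lemma Y_theta_c_law {d1 : measure_display} {T1 : measurableType d1}
    (P1 : probability T1 R) (M1 : {RV P1 >-> R})
    {d2 : measure_display} {T2 : measurableType d2} (P2 : probability T2 R)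
    (Y2 : {RV P2 >-> R}) (fM : R -> R) :
    has_density P M `]0, +oo[ fM ->
    has_density P1 M1 `]0, +oo[ (M_tilted_pdf P theta G M c fM) ->
  is_Y_theta_c P theta M c P2 Y2 <->
  eq_in_distribution P2 Y2 P1 (ratio_transform c M1).
Proof.
move=> Mf M1d.
have mM1 : measurable_fun setT M1 by [].
have P1E A : measurable A -> P1 (ratio_transform c M1 @^-1` A) =
    (\int[P]_t ((w (M t))%:E * (\1_A (Y t))%:E))%E.
  move=> mA; rewrite -integral_indic_comp//; last first.
    exact: (measurableT_comp mratio mM1).
  pose h (x : R) := (\1_A (c * x / (c * x + 1)) : R)%:E.
  have mh : measurable_fun setT h.
    apply/measurable_EFinP; apply: (measurableT_comp _ mratio).
    exact: measurable_indic.
  have h0 x : (0 <= h x)%E by rewrite lee_fin.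
  rewrite [LHS](has_density_integral P1 M1 _ mM1 _ _ h M1d)//.
  exact: (M_tilted_pdf_integral fM h Mf).
split=> [[fY YfY Y2d] A mA|Y2M1].
  by rewrite P1E//; exact: ((Y_theta_c_density_iff _ _ _ YfY).1 Y2d).
have [fY YfY] := ratio_transform_density fM Mf.
exists fY => //; apply/(Y_theta_c_density_iff _ _ _ YfY) => A mA.
by rewrite -P1E//; exact: Y2M1.
Qed.

End fixed_c.

(** Two densities with equal integrals over every measurable [E] in the half line agree almost
    everywhere. For [fM] this integral is P(M in E), which undoing the tilt expresses through [Y1];
    the odds substitution at c = 1 then yields the formula. *)
Lemma M_density_of_Y (fM fY1 : R -> R) {d1 : measure_display}
    {T1 : measurableType d1} (P1 : probability T1 R) (Y1 : {RV P1 >-> R}) :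
    0 <= theta -> has_density P M `]0, +oo[ fM ->
    is_Y_theta_c P theta M 1 P1 Y1 -> has_density P1 Y1 `]0, 1[ fY1 ->
  {ae mu, forall x : R, 0 < x -> fM x =
    (1 + x) `^ (theta - 2) * fY1 (x / (1 + x)) *
    fine (power_moment P theta M 1)}.
Proof.
move=> theta0 Mf [fY YfY Y1d] Y1f; have [[mfM fM0 fM1] PM] := Mf.
have [[mfY1 fY10 _] _] := Y1f.
set N := fine _.
have N_gt0 : 0 < N.
  apply: fine_gt0; rewrite power_moment_gt0 ?ltr01//=.
  exact: le_lt_trans (power_moment_le1 1 ltr01 theta0) (ltry 1).
pose D : set R := `]0, +oo[%classic; pose J : set R := `]0, 1[%classic.
have D_gt0 x : D x -> 0 < x by rewrite /D/= in_itv/= andbT.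
have DJ x : D x -> J (x / (1 + x)).
  move=> /D_gt0 x0; rewrite /J/= in_itv/= divr_gt0 ?addr_gt0//=.
  by rewrite ltr_pdivrMr ?addr_gt0// mul1r ltrDr.
have mD : measurable D by exact: measurable_itv.
have mJ : measurable J by exact: measurable_itv.
have m1x : measurable_fun [set: R] (fun x => (1 + x)^-1).
  by apply: measurable_fun_inv; exact: measurable_funD.
have mx1x : measurable_fun [set: R] (fun x => x / (1 + x)).
  exact: measurable_funM.
have m1powR r : measurable_fun [set: R] (fun x => (1 + x) `^ r).
  apply: (measurableT_comp (@measurable_powR R r)).
  exact: measurable_funD.
pose g x := (1 + x) `^ (theta - 2) * fY1 (x / (1 + x)) * N.
have mg : measurable_fun D g.
  apply: measurable_funM => //; apply: measurable_funM.
    exact: measurable_funTS.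
  have DJ' : [set x / (1 + x) | x in D] `<=` J by move=> _ [x /DJ ? <-].
  exact: (measurable_comp mJ DJ' mfY1 (measurable_funTS mx1x)).
suff : ae_eq mu D (EFin \o fM) (EFin \o g).
  apply: filterS => x /= + x0.
  have Dx : D x by rewrite /D/= in_itv/= andbT.
  by move=> /(_ Dx) [].
apply: integral_ae_eq => //; last 2 first.
- exact/measurable_EFinP.
- move=> E ED mE.
  have EDE : E `&` D = E by apply/setIidl.
  rewrite -[in LHS]EDE -PM//.
  pose f1 := fY1 \_ J.
  have mf1 : measurable_fun setT f1.
    exact: (iffLR (measurable_restrictT _ _)).
  have f10 y : 0 <= f1 y.
    by rewrite /f1 patchE; case: ifPn => //; rewrite inE => /fY10.
  (* [k] is the product of [H] below and the density of [Y1], expressed in the variable x with y = x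
     / (1 + x). *)
  pose k (x : R) := \1_E x * (1 + x) `^ theta * N * f1 (x / (1 + x)).
  have mk : measurable_fun setT k.
    apply: measurable_funM; last exact: (measurableT_comp mf1 mx1x).
    apply: measurable_funM => //; exact: measurable_funM.
  have k0 x : 0 <= k x by rewrite !mulr_ge0 ?powR_ge0// ltW.
  (* The factor 1 is kept to match [integral_odds] at c = 1. *)
  pose odds (y : R) := y / (1 * (1 - y)).
  have modds : measurable_fun setT odds.
    apply: measurable_funM => //; apply: measurable_fun_inv.
    by apply: measurable_funM => //; exact: measurable_funB.
  (* The power and [N] cancel the weight of the tilt, so that the expectation of [H (Y1 t)] is P(M
     in E). *)
  pose H (y : R) := \1_E (odds y) * (1 + odds y) `^ theta * N.
  have mH : measurable_fun setT H.
    apply: measurable_funM => //; apply: measurable_funM.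
      by apply: (measurableT_comp _ modds); exact: measurable_indic.
    exact: (measurableT_comp (m1powR theta) modds).
  have H0 y : 0 <= H y by rewrite !mulr_ge0 ?powR_ge0// ltW.
  have mY1 : measurable_fun setT Y1 by [].
  have mEH : measurable_fun setT (fun y => (H y)%:E) by exact/measurable_EFinP.
  have EH0 y : (0 <= (H y)%:E)%E by rewrite lee_fin.
  have mEk : measurable_fun setT (fun y => (k y)%:E) by exact/measurable_EFinP.
  have Ek0 y : (0 <= (k y)%:E)%E by rewrite lee_fin.
  (* This expectation is computed twice: with the tilted density of [Y1], which leads back to [M],
     and then with [fY1]. *)
  transitivity (\int[P1]_t (H (Y1 t))%:E)%E.
    rewrite (has_density_integral P1 Y1 _ mY1 _ _ (fun y => (H y)%:E) Y1d)//.
    rewrite (Y_theta_c_pdf_integral 1 ltr01 theta0 fY (fun y => (H y)%:E))//.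
    rewrite -(integral_indic_comp P M mM)//.
    apply: ge0_ae_eq_integral => //.
    - by apply/measurable_EFinP; exact: measurableT_comp.
    - apply: emeasurable_funM.
        apply/measurable_EFinP; apply: measurable_funM => //.
        apply: (measurableT_comp (@measurable_powR R (- theta))).
        by apply: measurable_funD => //; exact: measurable_funM.
      apply: (measurableT_comp mEH).
      exact: measurable_ratio_transform.
    - by move=> t _; rewrite mule_ge0// lee_fin divr_ge0 ?powR_ge0// ltW.
    apply: filterS M_pos => t Mt0 _.
    have Mt1 : 0 < 1 + M t by rewrite addr_gt0.
    rewrite -EFinM /H /odds /ratio_transform !mul1r [M t + 1]addrC.
    have -> : M t / (1 + M t) / (1 - M t / (1 + M t)) = M t.
      field.
      have -> : 1 + M t - M t = 1 by rewrite addrK.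
      by rewrite oner_neq0 andbT gt_eqF.
    rewrite powRN -/N; congr EFin; field.
    by rewrite !gt_eqF// powR_gt0.
  rewrite (has_density_integral P1 Y1 _ mY1 _ _ (fun y => (H y)%:E) Y1f)//.
  transitivity (\int[mu]_(y in `]0%R, 1%R[) (k (odds y))%:E)%E.
    apply: eq_integral => y yJ; move: (yJ).
    rewrite inE/= in_itv/= => /andP[y0 y1].
    rewrite -EFinM /k -/(H y) (_ : odds y / _ = y) ?/f1 ?patchE ?yJ//.
    rewrite /odds mul1r; field.
    have : 1 - y != 0 by rewrite subr_eq0 gt_eqF.
    by move=> -> /=; rewrite subrK oner_neq0.
  rewrite (integral_odds 1 ltr01 (fun x => (k x)%:E))//.
  rewrite -[in RHS]EDE integral_mkcondl.
  apply: eq_integral => x xD; move: (xD); rewrite inE => Dx.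
  have x0 := D_gt0 _ Dx; have x1 : 0 < 1 + x by rewrite addr_gt0.
  rewrite epatch_indic /= -!EFinM; congr EFin.
  rewrite /k /g /f1 patchE ifT; last by rewrite inE; exact: DJ.
  (* The Jacobian 1 / (1 + x)^2 lowers the exponent from theta to theta - 2. *)
  rewrite !mul1r [x + 1]addrC powRB ?(gt_eqF x1) ?implybT//.
  rewrite (powR_mulrn 2 (ltW x1)).
  by field; rewrite gt_eqF.
apply/integrableP; split; first exact/measurable_EFinP.
suff -> : (\int[mu]_(x in D) `|(EFin \o fM) x| = 1)%E by rewrite ltry.
rewrite -fM1; apply: eq_integral => x; rewrite inE => Dx.
by rewrite /= ger0_norm ?fM0.
Qed.

End tilting.

(** * Assembly of the representation of the tilted W with claims (i), (ii) and (iii) *)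

Theorem theorem3p2 (R : realType) (theta b c : R)
    (d : measure_display) (T : measurableType d) (P : probability T R)
    (G M : {RV P >-> R}) (fM fW : R -> R)
    (theta_gt0 : 0 < theta) (b_gt0 : 0 < b) (c_gt0 : 0 < c)
    (G_pos : {ae P, forall t, 0 < G t}) (M_pos : {ae P, forall t, 0 < M t})
    (indep_GM : independent_RVs P G M)
    (G_gamma : is_gamma theta P G)
    (M_density : has_density P M `]0, +oo[ fM)
    (W_density : has_density P (fun t => G t * M t) `]0, +oo[ fW) :
  [/\
    (* the law of W~ is well defined, and W~ =d (b/c) G Y with G, Y independent *)
    is_pdf `]0, +oo[ (Wtilde_pdf P G M b c fW) /\
    (forall (d1 : measure_display) (T1 : measurableType d1)
        (P1 : probability T1 R) (Wt : {RV P1 >-> R}),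
      has_density P1 Wt `]0, +oo[ (Wtilde_pdf P G M b c fW) ->
      (exists (d2 : measure_display) (T2 : measurableType d2)
          (P2 : probability T2 R) (G2 Y2 : {RV P2 >-> R}),
        [/\ is_gamma theta P2 G2, is_Y_theta_c P theta M c P2 Y2,
            independent_RVs P2 G2 Y2 &
            eq_in_distribution P1 Wt P2 (fun t => b / c * G2 t * Y2 t)]) /\
      (forall (d2 : measure_display) (T2 : measurableType d2)
          (P2 : probability T2 R) (G2 Y2 : {RV P2 >-> R}),
        is_gamma theta P2 G2 -> is_Y_theta_c P theta M c P2 Y2 ->
        independent_RVs P2 G2 Y2 ->
        eq_in_distribution P1 Wt P2 (fun t => b / c * G2 t * Y2 t))),
    (* (i): the density of Y_{theta,c} is in is_Y_theta_c; the two forms of its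
       normalising constant agree *)
    power_moment P theta M c = laplace_GM P G M c,
    (* (ii) *)
    is_pdf `]0, +oo[ (M_tilted_pdf P theta G M c fM) /\
    (forall (d1 : measure_display) (T1 : measurableType d1)
        (P1 : probability T1 R) (M1 : {RV P1 >-> R})
        (d2 : measure_display) (T2 : measurableType d2)
        (P2 : probability T2 R) (Y2 : {RV P2 >-> R}),
      has_density P1 M1 `]0, +oo[ (M_tilted_pdf P theta G M c fM) ->
      is_Y_theta_c P theta M c P2 Y2 <->
      eq_in_distribution P2 Y2 P1 (ratio_transform c M1)) &
    (* (iii) *)
    forall (d1 : measure_display) (T1 : measurableType d1)
        (P1 : probability T1 R) (Y1 : {RV P1 >-> R}) (fY1 : R -> R),
      is_Y_theta_c P theta M 1 P1 Y1 ->
      has_density P1 Y1 `]0, 1[ fY1 ->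
      {ae lebesgue_measure, forall x : R, 0 < x ->
        fM x = (1 + x) `^ (theta - 2) * fY1 (x / (1 + x))
               * fine ('E_P[fun t => (1 + M t) `^ (- theta)])}].
Proof.
have theta0 := ltW theta_gt0.
pose law := Wtilde_eq_in_distribution P G M theta M_pos indep_GM G_gamma c
  c_gt0 theta0 b fW.
split.
- split.
    exact: (is_pdf_Wtilde P G M theta M_pos indep_GM G_gamma c c_gt0 theta0 b fW
      b_gt0 W_density).
  move=> d1 T1 P1 Wt Wtd; split; last first.
    move=> d2 T2 P2 G2 Y2 G2g Y2d indep2.
    exact: (law _ _ P1 Wt _ _ P2 G2 Y2 b_gt0 W_density Wtd G2g Y2d indep2).
  have [fY YfY] := ratio_transform_density P M c c_gt0 fM M_density.
  (* The required independent pair lives on the original sample space with the original [G]; only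
     the probability is changed. *)
  have [Q [Y' [QG QY GY]]] := exists_tilted_probability P G M theta M_pos
    indep_GM G_gamma c c_gt0 theta0 fY YfY.
  have YQ : is_Y_theta_c P theta M c Q Y' by exists fY.
  exists d, T, Q, G, Y'; split; [exact: QG|exact: YQ|exact: GY|].
  exact: (law _ _ P1 Wt _ _ Q G Y' b_gt0 W_density Wtd QG YQ GY).
- exact: (power_moment_laplace P G M theta M_pos indep_GM G_gamma c c_gt0).
- split.
    exact: (is_pdf_M_tilted P G M theta M_pos indep_GM G_gamma c c_gt0 theta0 fM
      M_density).
  move=> d1 T1 P1 M1 d2 T2 P2 Y2 M1d.
  exact: (Y_theta_c_law P G M theta M_pos indep_GM G_gamma c c_gt0 theta0
    P1 M1 P2 Y2 fM M_density M1d).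
- move=> d1 T1 P1 Y1 fY1 Y1d Y1f.
  have <- : power_moment P theta M 1 =
      ('E_P[fun t => ((1 + M t) `^ (- theta))%R])%E.
    rewrite /power_moment; congr expectation.
    by apply/funext => t; rewrite mul1r.
  exact: (M_density_of_Y P M theta M_pos fM fY1 P1 Y1 theta0 M_density Y1d Y1f).
Qed.
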